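(* For any triangular array $\{Y_{n1},Y_{n2},\ldots,Y_{nr_n}\}_{n\in\mathbb{N}}$ of row-wise independent nonnegative integer valued random variables, with $Y_n=\sum_{k=1}^{r_n}Y_{nk}$ and $\lambda_n=\sum_{k=1}^{r_n}\mathbf P(Y_{nk}\ge1)$, we have for every $n\in\mathbb{N}$ $$d_{\mathrm{TV}}(\mathcal D(Y_n),\mathrm{Po}(\lambda_n))\le\sum_{k=1}^{r_n}\left[\mathbf P(Y_{nk}\ge2)+\mathbf P(Y_{nk}\ge1)^2\right].$$
   Context: $\mathcal D(X)$ denotes the distribution of $X$; $\mathrm{Po}(\lambda)$ is the Poisson distribution with mean $\lambda$ ($\mathrm{Po}(0)$ being the point mass at $0$). For probability measures $\mu,\nu$ on $\mathbb{Z}_+=\{0,1,2,\ldots\}$, $d_{\mathrm{TV}}(\mu,\nu)=\sup_{A\subset\mathbb{Z}_+}|\mu(A)-\nu(A)|$. Row-wise independent means that for each $n$ the variables $Y_{n1},\ldots,Y_{nr_n}$ are independent. *)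

(* Defs.v *)
From HB Require Import structures.
From mathcomp Require Import all_boot all_order all_algebra.
From mathcomp Require Import all_classical all_reals all_analysis.

Set Implicit Arguments.
Unset Strict Implicit.
Unset Printing Implicit Defensive.

Import Order.TTheory GRing.Theory Num.Theory.

Local Open Scope classical_set_scope.
Local Open Scope ring_scope.
Local Open Scope ereal_scope.

(* Mutual independence of a finite family, as the product rule over every
   subfamily [J]; the intersection over an empty [J] is the whole space. *)
Definition independent_RVs (d d' : measure_display) (T : measurableType d)
    (T' : measurableType d') (R : realType) (P : probability T R)
    (I : finType) (X : I -> {RV P >-> T'}) : Prop :=
  forall (J : {set I}) (A : I -> set T'),
    (forall i, i \in J -> measurable (A i)) ->
    P (\bigcap_(i in [set` J]) (X i @^-1` A i)) =
    \prod_(i in J) P (X i @^-1` A i).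

(* Taken in \bar R, so that the supremum needs no boundedness side condition. *)
Definition tv_distance (R : realType) (mu nu : probability nat R) : \bar R :=
  ereal_sup [set `|mu A - nu A| | A in [set: set nat]].

(* The [nat] argument of [poisson_prob] occurs nowhere in its definition, so
   the value given to it is immaterial. A nonpositive rate, in particular
   rate 0, yields the Dirac measure at 0. *)
Definition Poisson (R : realType) (rate : R) : probability nat R :=
  poisson_prob rate 0%N.

Definition sum_RV (d : measure_display) (T : measurableType d) (R : realType)
    (P : probability T R) (r : nat) (X : 'I_r -> {RV P >-> nat}) : T -> nat :=
  fun w => (\sum_(k < r) X k w)%N.

Lemma measurable_sum_RV (d : measure_display) (T : measurableType d)
    (R : realType) (P : probability T R) (r : nat)
    (X : 'I_r -> {RV P >-> nat}) : measurable_fun [set: T] (sum_RV X).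
Proof.
rewrite /sum_RV; elim: r X => [|r IH] X.
  by under eq_fun do rewrite big_ord0; exact: measurable_cst.
under eq_fun do rewrite big_ord_recr/=.
apply: measurable_realfun.measurable_fun_addn; last exact: measurable_funPT.
exact: (IH (fun k => X (widen_ord (leqnSn r) k))).
Qed.

HB.instance Definition _ (d : measure_display) (T : measurableType d)
    (R : realType) (P : probability T R) (r : nat)
    (X : 'I_r -> {RV P >-> nat}) :=
  isMeasurableFun.Build _ _ _ _ (sum_RV X) (measurable_sum_RV X).

(* Main.v *)
(* Since Po(a) * Po(b) = Po(a + b), the summands can be replaced one at a time
   by Poisson variables, each replacement costing the error made on a single
   summand. For one variable Z with p = P(Z >= 1), the inequalities
   1 - p <= exp(- p) and p <= p exp(- p) + p ^ 2 bound the excess of the law of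
   Z over Po(p): it is nonpositive at 0, at most p ^ 2 at 1, and of total mass at
   most P(Z >= 2) beyond. All bounds are kept one-sided, hence between sums of
   nonnegative terms. *)
Require Import Defs.
From HB Require Import structures.
From mathcomp Require Import all_boot all_order all_algebra.
From mathcomp Require Import ring lra.
From mathcomp Require Import all_classical all_reals all_analysis.

Import Order.TTheory GRing.Theory Num.Theory.

Local Open Scope classical_set_scope.
Local Open Scope ring_scope.
Local Open Scope ereal_scope.

(** Countable additivity over the partition of [E] by the fibers of [f]; it serves below as the law
    of total probability. *)
Lemma measure_fibers {d : measure_display} {T : measurableType d}
    {R : realType} (mu : {measure set T -> \bar R}) (f : T -> nat)
    (mf : forall n, measurable (f @^-1` [set n])) (E : set T) :
  measurable E -> mu E = \sum_(n <oo) mu (E `&` f @^-1` [set n]).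
Proof.
move=> mE; rewrite -measure_semi_bigcup.
- congr (mu _); apply/seteqP; split => [x Ex | x [n _ []]//].
  by exists (f x).
- by move=> n; exact: measurableI.
- apply/trivIsetP => i j _ _ /eqP ij; apply/seteqP; split => // x.
  by move=> [[_ /= fi] [_ /= fj]]; apply: ij; rewrite -fi.
- by apply: bigcup_measurable => n _; exact: measurableI.
Qed.

(** * Poisson laws and their convolution *)

Lemma Poisson_set1 {R : realType} (rate : R) (n : nat) : (0 <= rate)%R ->
  Poisson rate [set n] = (rate ^+ n / n`!%:R * expR (- rate))%:E.
Proof.
rewrite le_eqVlt => /orP[/eqP <-|rate0]; rewrite /Poisson /= /poisson_prob.
  rewrite ltxx oppr0 expR0 mulr1 diracE; case: n => [|n].
    by rewrite mem_set// expr0 fact0 divr1.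
  by rewrite memNset// expr0n mul0r.
by rewrite rate0 esum_set1 ?lee_fin ?poisson_pmf_ge0// /poisson_pmf rate0.
Qed.

(** The binomial theorem for [(a + b) ^+ n], divided by [n!] and multiplied by [expR (- (a + b))].
    Terms with [j > n] vanish, their fiber being empty. *)
Lemma Poisson_add_set1 {R : realType} (a b : R) (n : nat) :
    (0 <= a)%R -> (0 <= b)%R ->
  \sum_(j <oo) Poisson b [set j] * Poisson a (addn j @^-1` [set n]) =
  Poisson (a + b)%R [set n].
Proof.
move=> a0 b0; rewrite (nneseries_split 0%N n.+1); last first.
  by move=> k _; rewrite mule_ge0.
rewrite add0n [X in _ + X]eseries0 ?adde0; last first.
  move=> k nk _; rewrite [X in Poisson a X](_ : _ = set0) ?measure0 ?mule0//.
  apply/seteqP; split => // m /= kmn.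
  by move: nk; rewrite -kmn ltnNge leq_addr.
rewrite big_mkord.
have fiber (j : 'I_n.+1) : addn j @^-1` [set n] = [set (n - j)%N].
  apply/seteqP; split => m /= mn; last by rewrite mn subnKC// -ltnS.
  by have := addKn j m; rewrite mn.
under eq_bigr do rewrite fiber !Poisson_set1// -EFinM.
rewrite sumEFin Poisson_set1 ?addr_ge0//; congr EFin.
rewrite opprD expRD exprDn !mulr_suml; apply: eq_bigr => j _.
have nj : (j <= n)%N by rewrite -ltnS.
have fact_unit k : k`!%:R != 0%R :> R by rewrite pnatr_eq0 -lt0n fact_gt0.
have bin_unit : 'C(n, j)%:R != 0%R :> R by rewrite pnatr_eq0 -lt0n bin_gt0.
rewrite -[(_ *+ _)%R]mulr_natr -(bin_fact nj) !natrM.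
by field; rewrite bin_unit !fact_unit.
Qed.

(** Follows from the case of singletons by cutting [A] into points and exchanging the two
    nonnegative series. *)
Lemma Poisson_add {R : realType} (a b : R) (A : set nat) :
    (0 <= a)%R -> (0 <= b)%R ->
  \sum_(j <oo) Poisson b [set j] * Poisson a (addn j @^-1` A) =
  Poisson (a + b)%R A.
Proof.
move=> a0 b0.
have finP j : Poisson b [set j] = (fine (Poisson b [set j]))%:E.
  by rewrite fineK// fin_num_measure.
transitivity (\sum_(j <oo) \sum_(n <oo)
    Poisson b [set j] * Poisson a (addn j @^-1` (A `&` [set n]))).
  apply: eq_eseriesr => j _.
  by rewrite (measure_fibers (Poisson a) (addn j))// finP -nneseriesZl.
rewrite nneseries_interchange => [|i j]; last by rewrite mule_ge0.
rewrite (measure_fibers (Poisson (a + b)%R) id)//.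
apply: eq_eseriesr => n _; rewrite preimage_id.
have [An|An] := pselect (A n).
  rewrite (_ : A `&` [set n] = [set n]); last by apply/setIidPr => _ ->.
  exact: Poisson_add_set1.
rewrite (_ : A `&` [set n] = set0); last first.
  by apply/seteqP; split => // k [Ak /= kn]; apply: An; rewrite -kn.
rewrite [RHS]measure0 eseries0// => k _ _.
by rewrite preimage_set0 measure0 mule0.
Qed.

(** Multiplying [1 - p <= expR (- p)] by [p] gives the second inequality. *)
Lemma Poisson1_bounds {R : realType} (p : R) :
  (0 <= p -> 1 - p <= expR (- p) /\ p <= p * expR (- p) + p ^+ 2)%R.
Proof.
move=> p0; have /= e := expR_ge1Dx (- p)%R; split=> //; nra.
Qed.

(** * Independence of one variable from a sum of others *)

Lemma measurable_sum_seq {d : measure_display} {T : measurableType d}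
    {I : Type} (X : I -> {mfun T >-> nat}) (s : seq I) :
  measurable_fun [set: T] (fun w => \sum_(k <- s) X k w)%N.
Proof.
elim: s => [|i s IH].
  by under eq_fun do rewrite big_nil; exact: measurable_cst.
under eq_fun do rewrite big_cons.
exact: measurable_realfun.measurable_fun_addn.
Qed.

Lemma measurable_preimage_nat {d : measure_display} {T : measurableType d}
    (f : T -> nat) (A : set nat) :
  measurable_fun [set: T] f -> measurable (f @^-1` A).
Proof. by move=> mf; rewrite -[X in measurable X]setTI; exact: mf. Qed.

(* The event about the sum is cut along the values of the vector
   [(X k)_(k <- s)], whose fibers are the boxes of the product rule. *)
Lemma independent_sum {d : measure_display} {T : measurableType d}
    {R : realType} {P : probability T R} {I : finType}
    (X : I -> {RV P >-> nat}) (i : I) (s : seq I) (j : nat) (A : set nat) :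
    independent_RVs X -> i \notin s ->
  P (X i @^-1` [set j] `&` (fun w => \sum_(k <- s) X k w)%N @^-1` A) =
  P (X i @^-1` [set j]) * P ((fun w => \sum_(k <- s) X k w)%N @^-1` A).
Proof.
move=> Xindep i_s; set S := fun w => _.
have mX k B : measurable (X k @^-1` B) by exact: measurable_preimage_nat.
have mS : measurable (S @^-1` A).
  exact/measurable_preimage_nat/measurable_sum_seq.
pose J : {set I} := finset (fun k => k \in s).
have iJ : i \notin J by rewrite inE.
(* The vector of values is coded by one natural number, so that [measure_fibers] applies; [pickle]
   is injective, so no fiber mixes two vectors. *)
pose F w := pickle [seq X k w | k <- s].
have fiberF w0 : F @^-1` [set F w0] =
    \bigcap_(k in [set` J]) (X k @^-1` [set X k w0]).
  apply/seteqP; split => w /=.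
    by move=> /(pcan_inj (@pickleK _))/eq_in_map e k; rewrite /= inE; exact: e.
  by move=> e; congr pickle; apply/eq_in_map => k ks; apply: e; rewrite /= inE.
have fiber_empty n : F @^-1` [set n] !=set0 \/ F @^-1` [set n] = set0.
  by have [->|/set0P] := eqVneq (F @^-1` [set n]) set0; [right|left].
have mF n : measurable (F @^-1` [set n]).
  case: (fiber_empty n) => [[w0 <-]|->//]; rewrite fiberF.
  exact: fin_bigcap_measurable.
have Pij : P (X i @^-1` [set j]) = (fine (P (X i @^-1` [set j])))%:E.
  by rewrite fineK// fin_num_measure.
rewrite (measure_fibers P F)//; last exact: measurableI.
rewrite [in RHS](measure_fibers P F mF _ mS) Pij -nneseriesZl// -Pij.
apply: eq_eseriesr => n _; rewrite -setIA.
case: (fiber_empty n) => [[w0 <-]|->]; last by rewrite !setI0 measure0 mule0.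
have SF w : F w = F w0 -> S w = S w0.
  move=> /(pcan_inj (@pickleK _))/eq_in_map e.
  by rewrite /S !big_seq; apply: eq_bigr => k /e.
have [Aw|Aw] := pselect (A (S w0)); last first.
  rewrite (_ : S @^-1` A `&` _ = set0) ?setI0 ?measure0 ?mule0//.
  by apply/seteqP; split => // w [/= ASw /SF Sw]; apply: Aw; rewrite -Sw.
rewrite (_ : S @^-1` A `&` _ = F @^-1` [set F w0]); last first.
  by apply/setIidPr => w /= /SF ->.
(* One box for both constraints; since [i] is not in [J], the product rule over [i |: J] splits off
   the factor of [X i]. *)
pose B k := if k == i then [set j] else [set X k w0].
rewrite fiberF.
have -> : X i @^-1` [set j] `&` \bigcap_(k in [set` J]) X k @^-1` [set X k w0]
    = \bigcap_(k in [set` (i |: J)%SET]) X k @^-1` B k.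
  apply/seteqP; split => w /=.
    case=> wi wJ k /=; rewrite in_setU1 /B; case: eqVneq => [->//|_ /=].
    exact: wJ.
  move=> wB; split.
    by have := wB i; rewrite /= in_setU1 eqxx /B eqxx; exact.
  move=> k /= kJ; have := wB k; rewrite /= in_setU1 kJ orbT /B.
  by case: eqVneq => [ki|_]; [rewrite ki (negbTE iJ) in kJ|exact].
transitivity (\prod_(k in (i |: J)%SET) P (X k @^-1` B k)); first exact: Xindep.
rewrite big_setU1//= /B eqxx; congr (_ * _).
transitivity (\prod_(k in J) P (X k @^-1` [set X k w0])); last exact/esym/Xindep.
by apply: eq_bigr => k kJ; case: eqVneq => // ki; rewrite ki (negbTE iJ) in kJ.
Qed.

(** Conditioning on [X i] gives a series of the same shape as in [Poisson_add], so that the two can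
    be compared term by term. *)
Lemma independent_sum_cons {d : measure_display} {T : measurableType d}
    {R : realType} {P : probability T R} {I : finType}
    (X : I -> {RV P >-> nat}) (i : I) (s : seq I) (A : set nat) :
    independent_RVs X -> i \notin s ->
  P ((fun w => \sum_(k <- i :: s) X k w)%N @^-1` A) =
  \sum_(j <oo) P (X i @^-1` [set j]) *
    P ((fun w => \sum_(k <- s) X k w)%N @^-1` (addn j @^-1` A)).
Proof.
move=> Xindep i_s; rewrite (measure_fibers P (X i)); first last.
- exact/measurable_preimage_nat/measurable_sum_seq.
- by move=> n; exact: measurable_preimage_nat.
apply: eq_eseriesr => j _; rewrite -independent_sum// setIC; congr (P _).
by apply/seteqP; split => w /= [Xj]; rewrite big_cons Xj.
Qed.

(** * Replacing a single summand *)

Lemma le_Poisson_set1 {d : measure_display} {T : measurableType d}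
    {R : realType} {P : probability T R} (Z : {RV P >-> nat}) (j : nat) :
  P (Z @^-1` [set j]) <=
  Poisson (fine (P [set w | (1 <= Z w)%N])) [set j] +
  (P ([set w | (2 <= Z w)%N] `&` Z @^-1` [set j]) +
   if j == 1%N then P [set w | (1 <= Z w)%N] ^+ 2 else 0).
Proof.
set p := P [set w | (1 <= Z w)%N].
have mZ B : measurable (Z @^-1` B) by exact: measurable_preimage_nat.
have mp : measurable [set w | (1 <= Z w)%N].
  exact: (mZ [set n | (1 <= n)%N]).
have pfin : p = (fine p)%:E by rewrite fineK// fin_num_measure.
have p0 : (0 <= fine p)%R by rewrite /p fine_ge0.
have [ep0 ep1] := Poisson1_bounds _ p0.
case: j => [|[|j]] /=.
- rewrite (_ : Z @^-1` [set 0%N] = ~` [set w | (1 <= Z w)%N]); last first.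
    by apply/seteqP; split => w /=; case: (Z w).
  rewrite probability_setC// -/p adde0 {1}pfin Poisson_set1// expr0 fact0 divr1 mul1r.
  by apply: (le_trans _ (leeDl _ _)); rewrite ?lee_fin.
- apply: (@le_trans _ _ p).
    by apply: le_measure; rewrite ?inE// => w /= ->.
  rewrite {1}pfin Poisson_set1// divr1 expr1.
  rewrite -expe2 [in X in X ^+ 2]pfin -EFin_expe addeCA -EFinD.
  by apply: (le_trans _ (leeDr _ _)); rewrite ?lee_fin.
(* From 2 on, the fiber lies inside the event [2 <= Z], so the Poisson mass is simply dropped. *)
- rewrite adde0 (_ : _ `&` _ = Z @^-1` [set j.+2]) ?leeDr//.
  by apply/setIidPr => w /= ->.
Qed.

(** The pointwise bound is weighted by [f] and summed; [f j <= 1] is applied to the error terms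
    only. In use, [f j] is the Poisson mass of [A] shifted by [j]. *)
Lemma le_Poisson_sum {d : measure_display} {T : measurableType d}
    {R : realType} {P : probability T R} (Z : {RV P >-> nat})
    (f : nat -> \bar R) :
    (forall j, 0 <= f j <= 1) ->
  \sum_(j <oo) P (Z @^-1` [set j]) * f j <=
  \sum_(j <oo) Poisson (fine (P [set w | (1 <= Z w)%N])) [set j] * f j +
  (P [set w | (2 <= Z w)%N] + P [set w | (1 <= Z w)%N] ^+ 2).
Proof.
move=> f01; set p := P [set w | (1 <= Z w)%N].
have f0 j : 0 <= f j by case/andP: (f01 j).
have f1 j : f j <= 1 by case/andP: (f01 j).
have mZ B : measurable (Z @^-1` B) by exact: measurable_preimage_nat.
(* The constant [p ^+ 2] becomes a series concentrated at 1, to allow a termwise comparison. *)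
pose e j := if j == 1%N then p ^+ 2 else 0.
have p0 : 0 <= p by rewrite /p.
have e0 j : 0 <= e j by rewrite /e; case: ifP => // _; exact: expe_ge0.
have -> : p ^+ 2 = \sum_(j <oo) e j.
  rewrite (nneseriesD1 (n := 1%N))// eseries0 ?adde0//.
  by move=> k _ /andP[_ /negbTE k1]; rewrite /e k1.
have m2 : measurable [set w | (2 <= Z w)%N].
  exact: (mZ [set n | (2 <= n)%N]).
rewrite (measure_fibers P Z _ _ m2)//.
apply: (@le_trans _ _ (\sum_(j <oo) (Poisson (fine p) [set j] * f j +
    (P ([set w | (2 <= Z w)%N] `&` Z @^-1` [set j]) + e j)))); last first.
  rewrite nneseriesD => [|j _ _|j _ _]; last 2 first.
  - by rewrite mule_ge0.
  - by rewrite adde_ge0.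
  by rewrite leeD2l// nneseriesD.
apply: lee_nneseries => [j _ _|j _]; first by rewrite mule_ge0.
apply: le_trans (lee_wpmul2r (f0 j) (le_Poisson_set1 Z j)) _.
rewrite ge0_muleDl// ?adde_ge0//; last exact: e0.
rewrite leeD2l// -[leRHS]mule1 lee_wpmul2l// adde_ge0//; exact: e0.
Qed.

(** * Replacing all summands *)

Lemma sum_le_Poisson {d : measure_display} {T : measurableType d}
    {R : realType} {P : probability T R} {I : finType}
    (X : I -> {RV P >-> nat}) (s : seq I) (A : set nat) :
    independent_RVs X -> uniq s ->
  P ((fun w => \sum_(k <- s) X k w)%N @^-1` A) <=
  Poisson (fine (\sum_(k <- s) P [set w | (1 <= X k w)%N])) A +
  \sum_(k <- s) (P [set w | (2 <= X k w)%N] + P [set w | (1 <= X k w)%N] ^+ 2).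
Proof.
move=> Xindep; elim: s A => [|i s IH] A.
  (* The empty sum is 0 and the law of rate 0 is the Dirac measure at 0. *)
  rewrite !big_nil adde0 /Poisson /= /poisson_prob ltxx diracE => _.
  have [A0|A0] := pselect (A 0%N).
    rewrite mem_set// probability_le1//.
    exact/measurable_preimage_nat/measurable_sum_seq.
  rewrite (_ : _ @^-1` _ = set0) ?measure0//.
  by apply/seteqP; split => // w; rewrite /= big_nil.
rewrite cons_uniq => /andP[i_s s_uniq].
rewrite independent_sum_cons// !big_cons.
pose p k := P [set w | (1 <= X k w)%N].
set eps := \sum_(k <- s) (_ + _).
have mX k n : measurable [set w | (n <= X k w)%N].
  exact: (measurable_preimage_nat (X k) [set m | (n <= m)%N]).
have pfin k : p k \is a fin_num by rewrite fin_num_measure.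
have eps0 : 0 <= eps.
  by apply: sume_ge0 => k _; rewrite adde_ge0// expe_ge0.
have epsfin : eps \is a fin_num.
  apply/sum_fin_numP => k _ _.
  by rewrite fin_numD fin_numX ?pfin// fin_num_measure.
rewrite -/(p i) fineD//; last by apply/sum_fin_numP => k _ _; exact: pfin.
rewrite [(fine _ + _)%R]addrC -Poisson_add; first last.
- by apply: fine_ge0; exact: measure_ge0.
- by apply: fine_ge0; exact: sume_ge0.
set lam := fine (\sum_(k <- s) _).
rewrite (addeC (_ + _ ^+ 2)) [leRHS]addeA.
(* The tail is replaced first, for each value [j] of [X i]; the errors add up to [eps], as the
   weights have total mass 1. Then [X i] itself is replaced. *)
apply: (@le_trans _ _ (\sum_(j <oo) (P (X i @^-1` [set j]) *
    Poisson lam (addn j @^-1` A) + eps * P (X i @^-1` [set j])))).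
  apply: lee_nneseries => [j _ _|j _]; first by rewrite mule_ge0.
  rewrite (muleC eps) -ge0_muleDr//; apply: lee_wpmul2l => //; exact: IH.
rewrite nneseriesD//; last 2 first.
- by move=> j _ _; rewrite mule_ge0.
- by move=> j _ _; rewrite mule_ge0.
rewrite -{1}(fineK epsfin) nneseriesZl// fineK//.
have -> : \sum_(j <oo) P (X i @^-1` [set j]) = 1.
  rewrite -(probability_setT P) (measure_fibers P (X i))//.
    by apply: eq_eseriesr => j _; rewrite setTI.
  by move=> n; exact: measurable_preimage_nat.
rewrite mule1 addeAC leeD2r//; apply: le_Poisson_sum => j.
by rewrite measure_ge0 probability_le1.
Qed.

(* Passing to the complement turns a one-sided bound into a two-sided one. *)
Lemma tv_distance_le {R : realType} (mu nu : probability nat R) (e : \bar R) :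
  (forall A, mu A <= nu A + e) -> tv_distance mu nu <= e.
Proof.
move=> mu_nu; apply: ub_ereal_sup => _ [A _ <-].
have fin (m : probability nat R) : m A = (fine (m A))%:E.
  by rewrite fineK// fin_num_measure.
have := mu_nu A; have := mu_nu (~` A).
rewrite !probability_setC// (fin mu) (fin nu).
(* The bound is trivial for [+oo], and [-oo] contradicts the hypothesis. *)
case: e {mu_nu} => [e| |]; last 2 first.
- by move=> _ _; rewrite leey.
- by rewrite !addeNy.
rewrite -!EFinD !lee_fin => h1 h2; rewrite ler_norml; apply/andP; split; lra.
Qed.

Theorem theorem5p1p2 (R : realType) (d : nat -> measure_display)
    (T : forall n : nat, measurableType (d n))
    (P : forall n : nat, probability (T n) R)
    (r : nat -> nat)
    (Y : forall n : nat, 'I_(r n) -> {RV (P n) >-> nat})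
    (Yindep : forall n : nat, independent_RVs (Y n)) :
  forall n : nat,
    tv_distance (distribution (P n) (sum_RV (Y n)))
      (Poisson (fine (\sum_(k < r n) P n [set w | (1 <= Y n k w)%N])%E))
    <= \sum_(k < r n)
         (P n [set w | (2 <= Y n k w)%N] + P n [set w | (1 <= Y n k w)%N] ^+ 2).
Proof.
move=> n; apply: tv_distance_le => A.
(* Sums over ['I_(r n)] run over its enumeration, a list without repetition. *)
exact: (sum_le_Poisson _ _ A (Yindep n) (index_enum_uniq _)).
Qed.
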